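(* Let $1<q<\infty$ and $q/(q+1)<p<\infty$. Then, for all $x\in(0,\pi_{p,q}/2)$, $$\cos_{p,q}^{1/(q+1)}x<\frac{\sin_{p,q}x}{x}<1.$$ Moreover, for all $x\in(0,\pi_{r,q}/2)$, where $r=\frac{pq}{pq+p-q}$ (i.e. $\frac1p+\frac1r=1+\frac1q$), $$\cosh_{p,q}^{1/(q+1)}x<\frac{\sinh_{p,q}x}{x}<\cosh_{p,q}^{p/q}x.$$
   Context: For $1<q<\infty$ and $q/(q+1)<p<\infty$ (note that $p\le 1$ is allowed): Let $F_{p,q}(y)=\int_0^y \frac{dt}{(1-t^q)^{1/p}}$ for $y\in[0,1)$ and $\pi_{p,q}=2\int_0^1\frac{dt}{(1-t^q)^{1/p}}\in(0,\infty]$, which is finite for $p>1$ and equals $\infty$ for $p\le 1$. The function $\sin_{p,q}:[0,\pi_{p,q}/2)\to[0,1)$ is the inverse of $F_{p,q}$, and $\cos_{p,q}x=\frac{d}{dx}\sin_{p,q}x$. Let $G_{p,q}(y)=\int_0^y \frac{dt}{(1+t^q)^{1/p}}$ for $y\in[0,\infty)$. With $r=r(p)$ defined by $\frac1p+\frac1r=1+\frac1q$ (so that $r>q/(q+1)$ as well), $\sinh_{p,q}:[0,\pi_{r,q}/2)\to[0,\infty)$ is the inverse of $G_{p,q}$ (one has $\lim_{y\to\infty}G_{p,q}(y)=\pi_{r,q}/2$), and $\cosh_{p,q}x=\frac{d}{dx}\sinh_{p,q}x$. The notation $\sin_{p,q}^a x$ means $(\sin_{p,q}x)^a$, and similarly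 for the other functions. *)

(* Defs.v *)
From mathcomp Require Import all_boot all_order all_algebra.
From mathcomp Require Import all_classical all_reals all_analysis.
Set Implicit Arguments.
Unset Strict Implicit.
Unset Printing Implicit Defensive.
Import Order.TTheory GRing.Theory Num.Theory.
Import numFieldNormedType.Exports.
Local Open Scope classical_set_scope.
Local Open Scope ring_scope.

Section generalized_trigonometric_functions.
Context {R : realType}.
Implicit Types p q x y : R.

Local Notation mu := (@lebesgue_measure R).

Definition F_pq p q y : R :=
  \int[mu]_(t in `[0, y]) ((1 - t `^ q) `^ p^-1)^-1.

Definition G_pq p q y : R :=
  \int[mu]_(t in `[0, y]) ((1 + t `^ q) `^ p^-1)^-1.

(* Extended-real valued, since the integral is infinite for p <= 1. The
   endpoint 1, where the integrand is singular, is left out of the domain. *)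
Definition pi_pq p q : \bar R :=
  (2%:E * \int[mu]_(t in `[0%R, 1%R[) (((1 - t `^ q) `^ p^-1)^-1)%:E)%E.

(* The inverse functions are extended by 0 outside the image of F_pq (resp.
   G_pq). Hence the two-sided derivatives cos_pq and cosh_pq are meaningful
   only in the interior of the domains of sin_pq and sinh_pq. *)
Definition sin_pq p q : R -> R := 'pinv_(fun=> 0) `[0, 1[ (F_pq p q).

Definition cos_pq p q : R -> R := derive1 (sin_pq p q).

Definition sinh_pq p q : R -> R := 'pinv_(fun=> 0) `[0, +oo[ (G_pq p q).

Definition cosh_pq p q : R -> R := derive1 (sinh_pq p q).

End generalized_trigonometric_functions.

(* Main.v *)
(* Writing x as the integral over [0, y] of (1 + s t^q)^(-1/p), with s = -1 for
   sin and s = 1 for sinh, the derivative of the inverse function at x is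
   (1 + s y^q)^(1/p). Each inequality thus compares the integral with a function
   y (1 + s y^q)^c vanishing at 0, and it suffices to compare derivatives; for
   the two lower bounds, where c = -1/(p(q+1)), this comparison is Bernoulli's
   inequality (1 + v)^k < 1 + k v with v = s t^q and k = 1 - q/(p(q+1)).
   The substitution t = z (1 - z^q)^(-1/q) transforms G_{p,q} into F_{r,q}, so
   every x < pi_{r,q}/2 is a value of G_{p,q}. *)
Require Import Defs.
From mathcomp Require Import all_boot all_order all_algebra.
From mathcomp Require Import all_classical all_reals all_analysis.
From mathcomp Require Import ring lra.
Set Implicit Arguments.
Unset Strict Implicit.
Unset Printing Implicit Defensive.
Import Order.TTheory GRing.Theory Num.Theory.
Import numFieldNormedType.Exports.
Local Open Scope classical_set_scope.
Local Open Scope ring_scope.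

(** * Comparison of increments through derivatives *)

Section increments.
Context {R : realType}.
Implicit Types (g h dg dh : R -> R) (a b : R).

(** Mean value theorem for [h - g]. A single point [c] serves both functions, so the sign or the
    vanishing of [dh - dg] passes to the increments. *)
Lemma increment_sub g h dg dh a b : a < b ->
  (forall t, t \in `]a, b[ -> is_derive t 1 g (dg t)) ->
  (forall t, t \in `]a, b[ -> is_derive t 1 h (dh t)) ->
  {within `[a, b], continuous g} -> {within `[a, b], continuous h} ->
  exists2 c, c \in `]a, b[ &
    (h b - h a) - (g b - g a) = (dh c - dg c) * (b - a).
Proof.
move=> ab dgP dhP cg ch.
have [|c cab e] := @MVT R (h - g) (dh - dg) a b ab _ (within_continuousB ch cg).
  by move=> t tab; apply: is_deriveB; [exact: dhP|exact: dgP].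
by exists c => //; rewrite -e !fctE; ring.
Qed.

Lemma ltr_increment g h dg dh a b : a < b ->
  (forall t, t \in `]a, b[ -> is_derive t 1 g (dg t)) ->
  (forall t, t \in `]a, b[ -> is_derive t 1 h (dh t)) ->
  {within `[a, b], continuous g} -> {within `[a, b], continuous h} ->
  (forall t, t \in `]a, b[ -> dg t < dh t) ->
  g b - g a < h b - h a.
Proof.
move=> ab dgP dhP cg ch lt_d.
have [c cab e] := increment_sub ab dgP dhP cg ch.
by rewrite -subr_gt0 e mulr_gt0 ?subr_gt0 ?lt_d.
Qed.

Lemma eq_increment g h dg dh a b : a < b ->
  (forall t, t \in `]a, b[ -> is_derive t 1 g (dg t)) ->
  (forall t, t \in `]a, b[ -> is_derive t 1 h (dh t)) ->
  {within `[a, b], continuous g} -> {within `[a, b], continuous h} ->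
  (forall t, t \in `]a, b[ -> dg t = dh t) ->
  g b - g a = h b - h a.
Proof.
move=> ab dgP dhP cg ch eq_d.
have [c cab e] := increment_sub ab dgP dhP cg ch.
by apply/eqP; rewrite eq_sym -subr_eq0 e eq_d// subrr mul0r.
Qed.

End increments.

(** * Bernoulli's inequality, continuity and derivatives of real powers *)

Section powers.
Context {R : realType}.
Implicit Types (c q s t v k x y : R) (g : R -> R).

(** Strict concavity of the logarithm, obtained from [ln x < x - 1] for positive [x != 1]. *)
Lemma powR_Bernoulli v k : -1 < v -> v != 0 -> 0 < k < 1 ->
  (1 + v) `^ k < 1 + k * v.
Proof.
move=> v1 v0 /andP[k0 k1].
have v1_gt0 : 0 < 1 + v by lra.
have m_gt0 : 0 < 1 + k * v by nra.
rewrite {1}/powR gt_eqF// -[ltRHS]lnK ?posrE// ltr_expR.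
have ltx x : 0 < x -> x != 1 -> ln x < x - 1.
  move=> x0 x1; rewrite -ltr_expR lnK ?posrE//.
  have := @expR_gt1Dx R (x - 1); rewrite subr_eq0 => /(_ x1).
  by rewrite addrC subrK.
(* [m] is the mean of [1 + v] and [1] with weights [k] and [1 - k]. The bound on [ln] is applied to
   both points divided by [m]; neither quotient is 1 because [v != 0] and [0 < k < 1]. *)
set m := 1 + k * v in m_gt0 *.
have m_neq1 : m != 1 by rewrite -subr_eq0 /m addrAC subrr add0r mulf_neq0// gt_eqF.
have vm : v = (m - 1) / k by rewrite /m; field; rewrite gt_eqF.
have h1 : ln ((1 + v) / m) < (1 + v) / m - 1.
  apply: ltx; first by rewrite divr_gt0.
  apply/eqP => e; have : 1 + v = m.
    by apply: (divIf (lt0r_neq0 m_gt0)); rewrite e divff ?gt_eqF.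
  rewrite /m => /addrI e1; have : (1 - k) * v = 0 by rewrite mulrBl mul1r -e1 subrr.
  by move/eqP; rewrite mulf_eq0 (negbTE v0) orbF subr_eq0 => /eqP; lra.
have h2 : ln m^-1 < m^-1 - 1.
  by apply: ltx; rewrite ?invr_gt0// invr_eq1.
rewrite lnM ?posrE ?invr_gt0// in h1.
rewrite lnV ?posrE// in h1 h2.
(* The weighted sum of the two upper bounds vanishes, while that of the logarithms is
   [k * ln (1 + v) - ln m]. *)
have : k * ((1 + v) / m - 1) + (1 - k) * (m^-1 - 1) = 0.
  by rewrite /m; field; rewrite gt_eqF.
nra.
Qed.

Lemma powR_within_continuous q : 0 < q ->
  {within `[0, +oo[, continuous (fun t : R => t `^ q)}.
Proof.
move=> q0; apply/(continuous_within_itvcyP 0); split.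
  move=> x; rewrite in_itv/= andbT => x0.
  by apply/differentiable_continuous/derivable1_diffP/derivable_powR;
    rewrite in_itv/= x0.
by rewrite powR0 ?gt_eqF//; exact: powR_cvg0.
Qed.

Lemma powR_split x c : 0 < x -> x `^ c = x `^ (c - 1) * x.
Proof.
move=> x0; rewrite -[X in _ * X]powRr1 ?ltW// -powRD ?subrK//.
by rewrite (gt_eqF x0) implybT.
Qed.

Lemma within_continuous_powR (A : set R) g c :
  {within A, continuous g} -> (forall x, A x -> 0 < g x) ->
  {within A, continuous (fun x => g x `^ c)}.
Proof.
move=> cg g0.
apply: (@within_continuous_comp _ _ _ A g (fun y => y `^ c)) => //.
move=> _ /set_mem[x Ax <-].
by apply/differentiable_continuous/derivable1_diffP/derivable_powR;
  rewrite in_itv/= g0.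
Qed.

Lemma within_continuous_1Dpowq q s y : 0 < q ->
  {within `[0, y], continuous (fun t : R => 1 + s * t `^ q)}.
Proof.
move=> q0.
apply: (@within_continuous_comp _ _ _ _ (fun t => t `^ q) (fun y => 1 + s * y)).
  by move=> z _; apply: cvgD; [exact: cvg_cst|exact: mulrl_continuous].
have sub : `[0, y] `<=` `[0, +oo[.
  by move=> z /=; rewrite !in_itv/= andbT => /andP[].
exact: (continuous_subspaceW sub (powR_within_continuous q0)).
Qed.

(** Pulling out the power [c - 1] leaves a factor affine in [t ^ q], namely [1 + (1 + c q) s t ^ q].
    It is the right-hand side of Bernoulli's inequality for [k = 1 + c q], and it equals 1 for
    [c = - 1/q]. *)
Lemma is_derive_1Dpowq q s c t : 0 < t -> 0 < 1 + s * t `^ q ->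
  is_derive t 1 (fun u : R => u * (1 + s * u `^ q) `^ c)
    ((1 + s * t `^ q) `^ (c - 1) * (1 + s * t `^ q + c * q * s * t `^ q)).
Proof.
move=> t0 h0.
have d1 : is_derive t 1 (fun u : R => 1 + s * u `^ q) (s * (q * t `^ (q - 1))).
  have dq := @is_derive1_powR R q t t0.
  exact: (is_derive_eq (is_deriveD (is_derive_cst (1 : R) t 1)
    (is_deriveZ s dq)) (add0r _)).
have d2 := @is_derive1_comp R (@powR R ^~ c) (fun u => 1 + s * u `^ q) t _ _
  (@is_derive1_powR R c _ h0) d1.
apply: (is_derive_eq (is_deriveM (is_derive_id t 1) d2)).
rewrite /GRing.scale /= mulr1 (powR_split c h0) (powR_split q t0).
set X := _ `^ (c - 1); set T := _ `^ (q - 1); ring.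
Qed.

End powers.

(** * Intervals starting at 0, and positivity of [1 + s * y ^ q] on them *)

Section domains.
Context {R : realType}.
Implicit Types (b : itv_bound R) (c q y z : R).

Lemma itv0_ge0 b y : [set` Interval (BLeft 0) b] y -> 0 <= y.
Proof. by rewrite /= itv_boundlr bnd_simp => /andP[]. Qed.

Lemma itv0_down b y z : [set` Interval (BLeft 0) b] y -> 0 <= z -> z <= y ->
  [set` Interval (BLeft 0) b] z.
Proof.
rewrite /= !itv_boundlr !bnd_simp => /andP[_ yb] -> zy /=.
by apply: le_trans yb; rewrite bnd_simp.
Qed.

Lemma itv01_up y : `[0, 1[%classic y -> exists2 u : R, y < u & `[0, 1[%classic u.
Proof.
rewrite /= in_itv/= => /andP[y0 y1]; exists ((y + 1) / 2); first by lra.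
by rewrite /= in_itv/=; apply/andP; split; lra.
Qed.

Lemma itv0y_up y : `[0, +oo[%classic y -> exists2 u : R, y < u & `[0, +oo[%classic u.
Proof.
rewrite /= in_itv/= andbT => y0; exists (y + 1); first by lra.
by rewrite /= in_itv/= andbT; lra.
Qed.

Lemma powR_lt1 c y : 0 < c -> 0 <= y -> y < 1 -> y `^ c < 1.
Proof.
move=> c0 y0 y1; have <- : (1 : R) `^ c = 1 by rewrite powR1.
by rewrite gt0_ltr_powR ?nnegrE.
Qed.

(** The factor [-1] is kept so that the statement is literally the case [s = -1] of the general base
    [1 + s * y ^ q]. *)
Lemma itv01_base q y : 0 < q -> `[0, 1[%classic y -> 0 < 1 + -1 * y `^ q.
Proof.
rewrite /= in_itv/= => q0 /andP[y0 y1]; rewrite mulN1r subr_gt0.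
exact: powR_lt1.
Qed.

Lemma itv0y_base q y : `[0, +oo[%classic y -> 0 < 1 + 1 * y `^ q.
Proof. by move=> _; rewrite mul1r ltr_wpDr ?powR_ge0. Qed.

End domains.

(** * The primitive of a positive continuous function on an interval starting at 0, and its
    inverse *)

Section primitive.
Context {R : realType} (b : itv_bound R) (f : R -> R).
Local Notation D := [set` Interval (BLeft (0 : R)) b].
Local Notation mu := (@lebesgue_measure R).
Hypothesis D_up : forall y, D y -> exists2 u, y < u & D u.
Hypothesis f_cont : forall y, D y -> {within `[0, y], continuous f}.
Hypothesis f_gt0 : forall y, D y -> 0 < f y.

Let J (y : R) : R := \int[mu]_(t in `[0, y]) f t.

Lemma primitive_integrable y : D y -> mu.-integrable `[0, y] (EFin \o f).
Proof.
move=> Dy; apply: continuous_compact_integrable (f_cont Dy).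
exact: segment_compact.
Qed.

Lemma primitive0 : J 0 = 0.
Proof. by rewrite /J set_itv1 Rintegral_set1. Qed.

(** Since [D] has no greatest element, [y] is interior to some [[0, u]] inside [D], where the
    fundamental theorem of calculus gives a two-sided derivative. *)
Lemma is_derive_primitive y : D y -> 0 < y -> is_derive y 1 J (f y).
Proof.
move=> Dy y0; have [u yu Du] := D_up Dy.
have u0 := lt_trans y0 yu.
have fy : {for y, continuous f}.
  by apply: (within_continuous_continuous u0 (f_cont Du)); rewrite in_itv/= y0.
have [dJ eJ] := continuous_FTC1_closed yu (primitive_integrable Du) y0 fy.
by split=> //; rewrite -derive1E.
Qed.

(* Continuity at 0 is two-sided: the integral over the empty interval [0, y]
   vanishes for y < 0. *)
Lemma primitive_continuous y : D y -> {for y, continuous J}.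
Proof.
move=> Dy; have [y0|y0] := ltP 0 y.
  have [dJ _] := is_derive_primitive Dy y0.
  exact/differentiable_continuous/derivable1_diffP.
have -> : y = 0 by apply/eqP; rewrite eq_le y0 (itv0_ge0 Dy).
have D0 : D 0 by apply: (itv0_down Dy) => //; exact: (itv0_ge0 Dy).
have [u u0 Du] := D_up D0.
suff : J x @[x --> 0] --> J 0 by [].
rewrite primitive0.
exact: parameterized_integral_cvg_left u0 (primitive_integrable Du).
Qed.

Lemma primitive_within_continuous y : D y -> {within `[0, y], continuous J}.
Proof.
move=> Dy; apply: (@continuous_subspace_itv _ `[0, y] J) => z.
rewrite in_itv/= => /andP[z0 zy]; apply: primitive_continuous.
exact: itv0_down zy.
Qed.

Lemma primitive_lt y z : D z -> 0 <= y -> y < z -> J y < J z.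
Proof.
move=> Dz y0 yz.
have cJ : {within `[y, z], continuous J}.
  apply: (@continuous_subspace_itv _ `[y, z] J) => w.
  rewrite in_itv/= => /andP[yw wz]; apply: primitive_continuous.
  by apply: itv0_down wz => //; exact: le_trans yw.
have dJ t : t \in `]y, z[ -> is_derive t 1 J (f t).
  rewrite in_itv/= => /andP[yt tz]; apply: is_derive_primitive.
    by apply: itv0_down (ltW tz) => //; rewrite (le_trans y0) ?ltW.
  exact: le_lt_trans yt.
have [c] := MVT yz dJ cJ.
rewrite in_itv/= => /andP[yc cz] e; rewrite -subr_gt0 e mulr_gt0 ?subr_gt0//.
by apply/f_gt0/(itv0_down Dz); rewrite ?(le_trans y0) ?ltW.
Qed.

Lemma primitive_inj : {in D &, injective J}.
Proof.
move=> y z /set_mem Dy /set_mem Dz e.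
have [yz|zy|//] := ltgtP y z.
- by have := primitive_lt Dz (itv0_ge0 Dy) yz; rewrite e ltxx.
- by have := primitive_lt Dy (itv0_ge0 Dz) zy; rewrite e ltxx.
Qed.

Lemma pinv_primitive y : D y -> 'pinv_(fun=> 0) D J (J y) = y.
Proof. by move=> Dy; apply: (pinvKV _ primitive_inj); exact/mem_set. Qed.

Lemma derive1_pinv_primitive y : D y -> 0 < y ->
  derive1 ('pinv_(fun=> 0) D J) (J y) = (f y)^-1.
Proof.
move=> Dy y0; have [u yu Du] := D_up Dy.
(* As [0 < y < u], a whole neighbourhood of [y] lies in [D]; there ['pinv] is a genuine left inverse
   of [J], not its default value 0. *)
have nearD : \forall z \near y, D z.
  near=> z; apply: (itv0_down Du); apply/ltW; near: z.
    exact: lt_nbhsr.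
  exact: lt_nbhsl.
rewrite derive1E.
suff /@derive_val -> : is_derive (J y) 1 ('pinv_(fun=> 0) D J) (f y)^-1 by [].
apply: is_derive_inverse.
- by apply: filterS nearD => z; exact: pinv_primitive.
- by apply: filterS nearD => z; exact: primitive_continuous.
- exact: is_derive_primitive.
- by rewrite gt_eqF// f_gt0.
Unshelve. all: by end_near. Qed.

Lemma primitive_onto y v : D y -> 0 <= v -> v <= J y ->
  exists2 z, 0 <= z <= y & J z = v.
Proof.
move=> Dy v0 vy.
have [|z] := @IVT _ J 0 y v (itv0_ge0 Dy) (primitive_within_continuous Dy).
- by rewrite primitive0 ge_min v0 le_max vy orbT.
by rewrite in_itv/= => zy <-; exists z.
Qed.

End primitive.

(** * The common integrand of [F_pq] and [G_pq] *)

Section integrand.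
Context {R : realType}.
Local Notation mu := (@lebesgue_measure R).
Implicit Types p q s t y x : R.

(** The sign [s] is a parameter so that the lower bounds for sin and sinh share one proof. *)
Definition integrand s p q t : R := ((1 + s * t `^ q) `^ p^-1)^-1.

Lemma integrandE s p q t : integrand s p q t = (1 + s * t `^ q) `^ (- p^-1).
Proof. by rewrite powRN. Qed.

Lemma F_pqE p q : F_pq p q = fun y => \int[mu]_(t in `[0, y]) integrand (-1) p q t.
Proof.
apply/funext => y; rewrite /F_pq; congr (Rintegral _ _ _).
by apply/funext => t; rewrite /integrand mulN1r.
Qed.

Lemma G_pqE p q : G_pq p q = fun y => \int[mu]_(t in `[0, y]) integrand 1 p q t.
Proof.
apply/funext => y; rewrite /G_pq; congr (Rintegral _ _ _).
by apply/funext => t; rewrite /integrand mul1r.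
Qed.

Section positive_base.
Variables (s q : R) (b : itv_bound R).
Local Notation D := [set` Interval (BLeft (0 : R)) b].
Hypothesis q_gt0 : 0 < q.
Hypothesis D_up : forall y, D y -> exists2 u, y < u & D u.
Hypothesis base_gt0 : forall y, D y -> 0 < 1 + s * y `^ q.

Lemma integrand_gt0 p y : D y -> 0 < integrand s p q y.
Proof. by move=> Dy; rewrite invr_gt0 powR_gt0 ?base_gt0. Qed.

Lemma base_within_continuous c y : D y ->
  {within `[0, y], continuous (fun t => (1 + s * t `^ q) `^ c)}.
Proof.
move=> Dy; apply: within_continuous_powR; first exact: within_continuous_1Dpowq.
by move=> z /=; rewrite in_itv/= => /andP[z0 zy]; apply/base_gt0/(itv0_down Dy).
Qed.

Lemma integrand_within_continuous p y : D y ->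
  {within `[0, y], continuous (integrand s p q)}.
Proof.
have -> : integrand s p q = fun t => (1 + s * t `^ q) `^ (- p^-1).
  by apply/funext => t; exact: integrandE.
exact: base_within_continuous.
Qed.

Lemma id_base_within_continuous c y : D y ->
  {within `[0, y], continuous (fun t => t * (1 + s * t `^ q) `^ c)}.
Proof.
move=> Dy x; apply: (@continuousM _ (subspace `[0, y]) id _ x).
  by apply: continuous_subspaceT => z; exact: cvg_id.
exact: base_within_continuous.
Qed.

Let J p y := \int[mu]_(t in `[0, y]) integrand s p q t.

Lemma D_itv y t : D y -> t \in `]0, y[ -> D t /\ 0 < t.
Proof.
rewrite in_itv/= => Dy /andP[t0 ty]; split=> //.
by apply: (itv0_down Dy); exact: ltW.
Qed.

Lemma is_derive_integral p y t : D y -> t \in `]0, y[ ->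
  is_derive t 1 (J p) (integrand s p q t).
Proof.
move=> Dy ty; have [Dt t0] := D_itv Dy ty.
exact: (is_derive_primitive D_up (@integrand_within_continuous p)).
Qed.

Lemma integral_within_continuous p y : D y -> {within `[0, y], continuous (J p)}.
Proof.
exact: (primitive_within_continuous D_up (@integrand_within_continuous p)).
Qed.

(** Both sides vanish at 0. After division of the derivatives by [(1 + v) ^ (- a - 1)], where
    [v = s * t ^ q], what remains is Bernoulli's inequality with exponent [1 - a * q]. *)
Lemma integral_lt_base p y : s != 0 -> q / (q + 1) < p -> D y -> 0 < y ->
  J p y < y * (1 + s * y `^ q) `^ (- (p * (q + 1))^-1).
Proof.
move=> s0 hp Dy y0; set a := (p * (q + 1))^-1.
have q1 : 0 < q + 1 by rewrite ltr_wpDr.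
have p0 : 0 < p by apply: lt_trans hp; rewrite divr_gt0.
have a0 : 0 < a by rewrite invr_gt0 mulr_gt0.
(* This is the hypothesis on [p] rewritten; it makes the Bernoulli exponent positive. *)
have aq1 : a * q < 1.
  by rewrite /a mulrC ltr_pdivrMr ?mulr_gt0// mul1r -ltr_pdivrMr.
have dg t : t \in `]0, y[ ->
    is_derive t 1 (fun u => u * (1 + s * u `^ q) `^ (- a))
      ((1 + s * t `^ q) `^ (- a - 1) * (1 + s * t `^ q + - a * q * s * t `^ q)).
  move=> /(D_itv Dy)[Dt t0].
  exact: is_derive_1Dpowq (base_gt0 Dt).
have := ltr_increment y0 (fun t => @is_derive_integral p y t Dy) dg
  (integral_within_continuous Dy) (id_base_within_continuous Dy).
rewrite [J p 0]primitive0 mul0r !subr0; apply => t ty.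
have [Dt t0] := D_itv Dy ty.
set v := s * t `^ q.
have B0 : 0 < 1 + v := base_gt0 Dt.
have B : (1 + v) `^ (1 - a * q) < 1 + (1 - a * q) * v.
  apply: powR_Bernoulli; first by lra.
    by apply: mulf_neq0 => //; rewrite gt_eqF ?powR_gt0.
  by rewrite subr_gt0 aq1/= gtrDl oppr_lt0 mulr_gt0.
rewrite integrandE -/v.
(* The choice of [a] amounts to [a * (q + 1) = p^-1], which is what lets the exponent split this
   way. *)
have -> : - p^-1 = (- a - 1) + (1 - a * q).
  by rewrite /a; field; rewrite !gt_eqF.
rewrite powRD ?(gt_eqF B0) ?implybT// ltr_pM2l ?powR_gt0//.
suff -> : 1 + s * t `^ q + - a * q * s * t `^ q = 1 + (1 - a * q) * v by [].
by rewrite /v; ring.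
Qed.

Lemma pinv_integral p y : D y -> 'pinv_(fun=> 0) D (J p) (J p y) = y.
Proof.
exact: (pinv_primitive D_up (@integrand_within_continuous p)
  (@integrand_gt0 p)).
Qed.

Lemma derive1_pinv_integral p y : D y -> 0 < y ->
  derive1 ('pinv_(fun=> 0) D (J p)) (J p y) = (1 + s * y `^ q) `^ p^-1.
Proof.
move=> Dy y0.
rewrite (derive1_pinv_primitive D_up
  (@integrand_within_continuous p) (@integrand_gt0 p) Dy y0).
by rewrite invrK.
Qed.

Lemma integrand_integral_gt0 p y : D y -> 0 < y -> 0 < J p y.
Proof.
move=> Dy y0; rewrite -[ltLHS](primitive0 (integrand s p q)).
exact: (primitive_lt D_up (@integrand_within_continuous p)
  (@integrand_gt0 p)).
Qed.

(** The left side is the power [1/(p(q+1))] of the base, so this is [integral_lt_base] rearranged.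
    It yields both lower bounds. *)
Lemma derive1_pinv_lt p y : s != 0 -> q / (q + 1) < p -> D y -> 0 < y ->
  derive1 ('pinv_(fun=> 0) D (J p)) (J p y) `^ (q + 1)^-1 < y / J p y.
Proof.
move=> s0 hp Dy y0; rewrite derive1_pinv_integral// -powRrM -invfM.
rewrite ltr_pdivlMr ?integrand_integral_gt0// mulrC -ltr_pdivlMr ?powR_gt0 ?base_gt0//.
by rewrite -powRN integral_lt_base.
Qed.

End positive_base.

End integrand.

(** * The upper bounds, the link between [G_pq] and [F_pq], and surjectivity *)

Section comparisons.
Context {R : realType}.
Implicit Types p q r x y z : R.
Local Notation mu := (@lebesgue_measure R).

(** The integrand exceeds 1, the derivative of the identity. This becomes [sin_pq p q x < x]. *)
Lemma F_pq_gt p q y : 0 < q -> 0 < p -> 0 < y < 1 -> y < F_pq p q y.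
Proof.
move=> q0 p0 /andP[y0 y1]; rewrite F_pqE.
have Dy : `[0, 1[%classic y by rewrite /= in_itv/= ltW.
have base := itv01_base q0.
have := ltr_increment y0 (fun t _ => is_derive_id t 1)
  (fun t => @is_derive_integral R (-1) q _ q0 (@itv01_up R) base p y t Dy)
  (continuous_subspaceT (fun z => cvg_id))
  (integral_within_continuous q0 (@itv01_up R) base Dy).
rewrite [X in _ - X < _ - _]/= [X in _ < _ - X]primitive0 !subr0; apply => t ty.
have [Dt t0] := D_itv Dy ty.
have := base _ Dt; rewrite /integrand => B0.
rewrite invf_gt1 ?powR_gt0//; apply: powR_lt1; rewrite ?invr_gt0 ?ltW//.
by rewrite mulN1r gtrDl oppr_lt0 powR_gt0.
Qed.

(** The left side has derivative [(1 + t ^ q) ^ (- 1/q - 1)], so two powers of a base larger than 1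
    are compared through their exponents. *)
Lemma G_pq_gt p q y : 1 < q -> q / (q + 1) < p -> 0 < y ->
  y * (1 + y `^ q) `^ (- q^-1) < G_pq p q y.
Proof.
move=> q1 hp y0; rewrite G_pqE.
have q0 : 0 < q by lra.
have p0 : 0 < p by apply: lt_trans hp; rewrite divr_gt0//; lra.
have Dy : `[0, +oo[%classic y by rewrite /= in_itv/= ltW.
have base := @itv0y_base R q.
have dg t : t \in `]0, y[ ->
    is_derive t 1 (fun u => u * (1 + 1 * u `^ q) `^ (- q^-1))
      ((1 + 1 * t `^ q) `^ (- q^-1 - 1) *
       (1 + 1 * t `^ q + - q^-1 * q * 1 * t `^ q)).
  move=> /(D_itv Dy)[Dt t0].
  exact: is_derive_1Dpowq (base _ Dt).
have := ltr_increment y0 dg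
  (fun t => @is_derive_integral R 1 q _ q0 (@itv0y_up R) base p y t Dy)
  (id_base_within_continuous q0 base Dy)
  (integral_within_continuous q0 (@itv0y_up R) base Dy).
rewrite [X in _ < _ - X]primitive0 mul0r !subr0 mul1r; apply => t ty.
have [Dt t0] := D_itv Dy ty.
rewrite integrandE !mul1r mulr1 mulNr mulVf ?gt_eqF// mulN1r addrK mulr1.
have t1 : 1 < 1 + t `^ q by rewrite ltrDl powR_gt0.
rewrite /powR gt_eqF ?(lt_trans ltr01)// ltr_expR ltr_pM2r ?ln_gt0//.
(* The hypothesis on [p] reads [1/p < 1 + 1/q], the required order of the exponents. *)
have : p^-1 < (q / (q + 1))^-1 by rewrite ltf_pV2 ?posrE// divr_gt0; lra.
by rewrite invf_div mulrDl divff ?gt_eqF// mul1r; lra.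
Qed.

(** The substitution is checked by differentiation. With [u = t ^ q], [1 + phi t ^ q = 1/(1 - u)]
    and [phi] has derivative [(1 - u) ^ (- 1/q - 1)], so the composite has derivative
    [(1 - u) ^ (1/p - 1/q - 1)], whose exponent is [- 1/r]. *)
Lemma G_pq_F_pq p q r z : 1 < q -> r^-1 = 1 + q^-1 - p^-1 -> 0 < z < 1 ->
  G_pq p q (z * (1 - z `^ q) `^ (- q^-1)) = F_pq r q z.
Proof.
move=> q1 hr /andP[z0 z1]; rewrite G_pqE F_pqE.
have q0 : 0 < q by lra.
have Dz : `[0, 1[%classic z by rewrite /= in_itv/= ltW.
have base := itv01_base q0.
have baseG := @itv0y_base R q.
pose phi t := t * (1 + -1 * t `^ q) `^ (- q^-1).
pose J y := \int[mu]_(t in `[0, y]) integrand 1 p q t.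
have phi0 : phi 0 = 0 by rewrite /phi mul0r.
have -> : z * (1 - z `^ q) `^ (- q^-1) = phi z by rewrite /phi mulN1r.
have phi_ge0 t : 0 <= t -> 0 <= phi t.
  by move=> t0; rewrite mulr_ge0 ?powR_ge0.
have dphi t : t \in `]0, z[ ->
    is_derive t 1 phi
      ((1 + -1 * t `^ q) `^ (- q^-1 - 1) *
       (1 + -1 * t `^ q + - q^-1 * q * -1 * t `^ q)).
  move=> /(D_itv Dz)[Dt t0].
  exact: is_derive_1Dpowq (base _ Dt).
have cphi : {within `[0, z], continuous phi}.
  exact: (id_base_within_continuous q0 base Dz).
have cf y (Dy : `[0, +oo[%classic y) :=
  integrand_within_continuous q0 baseG (p := p) Dy.
have dJ y : 0 < y -> is_derive y 1 J (integrand 1 p q y).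
  move=> y0; apply: (is_derive_primitive (@itv0y_up R) cf) => //.
  by rewrite /= in_itv/= ltW.
(* [phi] vanishes at 0, where [dJ] does not apply; continuity of [J] is therefore taken from
   [primitive_continuous]. *)
have cJphi : {within `[0, z], continuous (J \o phi)}.
  apply: within_continuous_comp => // _ /set_mem[t /= tz <-].
  apply: (primitive_continuous (@itv0y_up R) cf).
  by move: tz; rewrite /= !in_itv/= andbT => /andP[t0 _]; exact: phi_ge0.
have dJphi t : t \in `]0, z[ -> is_derive t 1 (J \o phi)
    (integrand 1 p q (phi t) * ((1 + -1 * t `^ q) `^ (- q^-1 - 1) *
       (1 + -1 * t `^ q + - q^-1 * q * -1 * t `^ q))).
  move=> tz; have [Dt t0] := D_itv Dz tz.
  apply: is_derive1_comp (dphi _ tz); apply: dJ.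
  by rewrite mulr_gt0 ?powR_gt0 ?base.
have := eq_increment z0 dJphi
  (fun t => @is_derive_integral R (-1) q _ q0 (@itv01_up R) base r z t Dz)
  cJphi
  (integral_within_continuous q0 (@itv01_up R) base Dz).
rewrite [X in _ = _ - X]primitive0 /= phi0 [J 0]primitive0 !subr0; apply => t tz.
have [Dt t0] := D_itv Dz tz.
have B0 := base _ Dt; rewrite mulN1r in B0 *.
rewrite !integrandE !mulN1r mul1r.
set u := t `^ q in B0 *.
have -> : (phi t) `^ q = u / (1 - u).
  rewrite /phi mulN1r powRM ?powR_ge0 ?(ltW t0)// -powRrM mulNr mulVf ?gt_eqF//.
  by rewrite powR_inv1 ?ltW.
have -> : 1 + u / (1 - u) = (1 - u) `^ (-1).
  by rewrite powR_inv1 ?(ltW B0)//; field; rewrite gt_eqF.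
have -> : 1 - u + - q^-1 * q * -1 * u = 1 by field; rewrite gt_eqF.
rewrite mulr1 -powRrM -powRD ?(gt_eqF B0) ?implybT// hr; congr (_ `^ _); ring.
Qed.

(** By the intermediate value theorem it is enough that [F_pq] reaches [x] somewhere. Otherwise
    monotone convergence bounds the integral over [[0, 1[] by [x]; the argument also covers an
    infinite [pi_pq]. *)
Lemma F_pq_onto p q x : 0 < q -> 0 < x -> (x%:E < pi_pq p q / 2%:E)%E ->
  exists2 y, 0 < y < 1 & F_pq p q y = x.
Proof.
move=> q0 x0 hx.
have base := itv01_base q0.
have cf y (Dy : `[0, 1[%classic y) :=
  integrand_within_continuous q0 base (p := p) Dy.
suff [y Dy xy] : exists2 y, `[0, 1[%classic y & x <= F_pq p q y.
  rewrite F_pqE in xy *.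
  have [z /andP[z0 zy] e] := primitive_onto (@itv01_up R) cf Dy (ltW x0) xy.
  exists z => //; move: Dy; rewrite /= in_itv/= => /andP[_ y1].
  rewrite (le_lt_trans zy y1) andbT lt_neqAle z0 andbT eq_sym.
  by apply/eqP => ze; move: x0; rewrite -e ze primitive0 ltxx.
apply: contrapT => Fx.
(* These right endpoints give closed intervals that exhaust [[0, 1[]. *)
have Ditv n : `[0, 1[%classic (1 - n.+1%:R^-1 : R).
  by rewrite /= in_itv/= subr_ge0 invf_le1 ?ler1n ?ltr0n//= gtrBl invr_gt0 ltr0n.
suff : (\int[mu]_(t in `[0%R, 1%R[) (((1 - t `^ q) `^ p^-1)^-1)%:E <= x%:E)%E.
  rewrite leNgt => /negP; apply; move: hx; rewrite /pi_pq.
  rewrite inver pnatr_eq0/= lte_pdivlMr// muleC.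
  by rewrite lte_pmul2l.
rewrite itv_bnd_open_bigcup.
have -> : (fun t => (((1 - t `^ q) `^ p^-1)^-1)%:E) = EFin \o integrand (-1) p q.
  by apply/funext => t; rewrite /= /integrand mulN1r.
apply: (cvge_le _ (ge0_nondecreasing_set_cvg_integral _ _ _ _)).
- apply: nearW => n.
  have := primitive_integrable cf (Ditv n).
  move=> /integrable_fin_num => /(_ (measurable_itv _)) /fineK <-.
  rewrite lee_fin leNgt; apply/negP => /ltW xn.
  by apply: Fx; exists (1 - n.+1%:R^-1) => //; rewrite F_pqE.
- move=> n m nm; apply/subsetPset => t /=; rewrite !in_itv/= => /andP[-> tn] /=.
  by rewrite (le_trans tn)// lerB// lef_pV2 ?posrE ?ltr0n// ler_nat.
- by move=> n; exact: measurable_itv.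
- by move=> n; case/integrableP: (primitive_integrable cf (Ditv n)).
- move=> n t _; rewrite lee_fin invr_ge0 powR_ge0//.
Qed.

End comparisons.

(** * The inequalities for the trigonometric and hyperbolic functions *)

Theorem theorem1p3 (R : realType) (p q : R)
    (hq : 1 < q) (hp : q / (q + 1) < p) :
  (forall x : R, 0 < x -> (x%:E < pi_pq p q / 2%:E)%E ->
     cos_pq p q x `^ (q + 1)^-1 < sin_pq p q x / x /\
     sin_pq p q x / x < 1) /\
  (forall r : R, r = p * q / (p * q + p - q) ->
   forall x : R, 0 < x -> (x%:E < pi_pq r q / 2%:E)%E ->
     cosh_pq p q x `^ (q + 1)^-1 < sinh_pq p q x / x /\
     sinh_pq p q x / x < cosh_pq p q x `^ (p / q)).
Proof.
have q0 : 0 < q by lra.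
have p0 : 0 < p by apply: lt_trans hp; rewrite divr_gt0//; lra.
split=> [x x0 xpi|r rE x x0 xpi].
  have [y y01 yx] := F_pq_onto q0 x0 xpi.
  have := F_pq_gt q0 p0 y01; rewrite yx => yltx.
  have [y0 _] := andP y01.
  have Dy : `[0, 1[%classic y by move: y01; rewrite /= in_itv/= => /andP[/ltW -> ->].
  have base := itv01_base q0.
  rewrite F_pqE in yx.
  rewrite /cos_pq /sin_pq F_pqE -yx (pinv_integral q0 (@itv01_up R) base)//.
  split; last by rewrite yx ltr_pdivrMr ?mul1r.
  by apply: (derive1_pinv_lt q0 (@itv01_up R) base) => //; rewrite oppr_eq0 oner_neq0.
have rV : r^-1 = 1 + q^-1 - p^-1.
  by rewrite rE invf_div; field; rewrite !gt_eqF.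
have [z z01 zx] := F_pq_onto q0 x0 xpi.
(* The preimage of [x] under [F_pq r q] is turned into a preimage [y] under [G_pq p q]. *)
rewrite -(G_pq_F_pq hq rV z01) in zx.
have [z0 z1] := andP z01.
set y := z * _ in zx.
have y0 : 0 < y by rewrite mulr_gt0 ?powR_gt0// subr_gt0 powR_lt1 ?ltW.
have := G_pq_gt hq hp y0; rewrite zx => yltx.
have Dy : `[0, +oo[%classic y by rewrite /= in_itv/= andbT ltW.
have base := @itv0y_base R q.
rewrite G_pqE in zx.
rewrite /cosh_pq /sinh_pq G_pqE -zx (pinv_integral q0 (@itv0y_up R) base)//.
split.
  by apply: (derive1_pinv_lt q0 (@itv0y_up R) base) => //; exact: oner_neq0.
(* Here [cosh_pq p q x ^ (p / q)] is [(1 + y ^ q) ^ (1/q)], so the claim is [G_pq_gt] rearranged. *)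
rewrite (derive1_pinv_integral q0 (@itv0y_up R) base)// zx mul1r.
rewrite -powRrM mulrA mulVf ?gt_eqF// mul1r.
have B0 : 0 < 1 + y `^ q by rewrite ltr_wpDr ?powR_ge0.
by rewrite ltr_pdivrMr// mulrC -ltr_pdivrMr ?powR_gt0// -powRN.
Qed.
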